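(* Let $\mathbf s=\mathcal P(W_0,\boldsymbol\varepsilon)$, where $W_0$ is a finite binary word and $\boldsymbol\varepsilon=(\varepsilon_k)_{k\ge0}$ is a periodic binary sequence, and let $W_1=W_0\,\varepsilon_0\,W_0$. Let $u_0=\sigma(W_1)$ and let $v_0=\overline{u_0}$ be the bitwise negation of $u_0$. Then $$\sigma(\mathbf s)=\mathcal G\bigl(u_0,v_0,(1-\delta_{\varepsilon_k,\varepsilon_{k+1}})_{k\ge0}\bigr),$$ where $\delta_{x,y}=1$ if $x=y$ and $\delta_{x,y}=0$ otherwise.
   Context: Binary words and sequences take values in $\{0,1\}$. Juxtaposition of words is concatenation. $\mathcal P(W_0,\boldsymbol\varepsilon)$ denotes the infinite sequence $\lim_k W_k$, where $W_{k+1}=W_k\,\varepsilon_k\,W_k$ for $k\ge0$. $\mathcal G(u_0,v_0,\boldsymbol\Upsilon)$, for finite words $u_0,v_0$ and a periodic $(0,1)$-sequence $\boldsymbol\Upsilon=(\Upsilon_k)_{k\ge0}$, denotes the infinite sequence $\lim_k u_k$, where for $k\ge0$: if $\Upsilon_k=0$, $u_{k+1}=u_ku_k$ and $v_{k+1}=v_kv_k$; if $\Upsilon_k=1$, $u_{k+1}=u_kv_k$ and $v_{k+1}=v_ku_k$. The operator $\sigma$ maps a binary sequence $(x_i)_{i\ge0}$ to $\left(\sum_{j=0}^{i-1}x_j\bmod 2\right)_{i\ge0}$. For a finite binary word $a=x_0\cdots x_{L-1}$ of length $L$, $\sigma(a)$ is the word of length $L+1$ whose $i$-th letter ($0\le i\le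 L$) is $\sum_{j=0}^{i-1}x_j\bmod 2$; its first letter is $0$ and its last letter is the parity of the number of $1$'s in $a$. *)

(* Defs.v *)
From HB Require Import structures.
From mathcomp Require Import all_boot.
From mathcomp Require Import boolp classical_sets.
Set Implicit Arguments.
Unset Strict Implicit.
Unset Printing Implicit Defensive.

Definition word := seq bool.
Definition binseq := nat -> bool.

Definition periodic (x : binseq) : Prop :=
  exists2 p, 0 < p & forall k, x (k + p) = x k.

Definition word_cvg (w : nat -> word) (x : binseq) : Prop :=
  forall i, exists K, forall k, K <= k ->
    i < size (w k) /\ nth false (w k) i = x i.

(* Unspecified when the words do not converge; [Pseq_cvg] and [Gseq_cvg] below
   show that they do in the cases of interest. *)
Definition word_lim (w : nat -> word) : binseq := get (word_cvg w).

Fixpoint Pword (W0 : word) (eps : binseq) (k : nat) : word :=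
  if k is k'.+1 then
    Pword W0 eps k' ++ [:: eps k'] ++ Pword W0 eps k'
  else W0.

Definition Pseq (W0 : word) (eps : binseq) : binseq := word_lim (Pword W0 eps).

Fixpoint Gpair (u0 v0 : word) (Y : binseq) (k : nat) : word * word :=
  if k is k'.+1 then
    let: (u, v) := Gpair u0 v0 Y k' in
    if Y k' then (u ++ v, v ++ u) else (u ++ u, v ++ v)
  else (u0, v0).

Definition Gseq (u0 v0 : word) (Y : binseq) : binseq :=
  word_lim (fun k => (Gpair u0 v0 Y k).1).

Definition sigma (x : binseq) : binseq :=
  fun i => odd (\sum_(0 <= j < i) x j).

Definition sigma_word (a : word) : word :=
  mkseq (fun i => odd (\sum_(0 <= j < i) nth false a j)) (size a).+1.

Definition negw (a : word) : word := map negb a.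

Definition delta (x y : bool) : bool := x == y.

Lemma word_cvg_unique w x y : word_cvg w x -> word_cvg w y -> x = y.
Proof.
move=> wx wy; apply/funext => i.
have [K HK] := wx i; have [M HM] := wy i.
have [_ <-] := HK _ (leq_maxl K M).
by have [_ <-] := HM _ (leq_maxr K M).
Qed.

Lemma word_limP w x : word_cvg w x -> word_lim w = x.
Proof. by move=> wx; apply: (word_cvg_unique _ wx); exact: (getPex (ex_intro _ x wx)). Qed.

Lemma word_cvg_prefix (w : nat -> word) :
  (forall k, prefix (w k) (w k.+1)) -> (forall k, k <= size (w k)) ->
  word_cvg w (word_lim w).
Proof.
move=> pw sw; apply: (@getPex _ (word_cvg w)).
exists (fun i => nth false (w i.+1) i) => i; exists i.+1 => k.
elim: k => // k IH; rewrite leq_eqVlt => /predU1P[<-|ik]; first by split.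
have [lt <-] := IH ik; have /prefixP[t ->] := pw k.
by rewrite size_cat nth_cat lt; split=> //; exact: ltn_addr.
Qed.

Lemma Pseq_cvg W0 eps : word_cvg (Pword W0 eps) (Pseq W0 eps).
Proof.
apply: word_cvg_prefix => k /=; first exact: prefix_prefix.
elim: k => //= k IH; rewrite !size_cat /= addnS ltnS.
by rewrite (leq_trans IH) ?leq_addr.
Qed.

Lemma Gseq_cvg u0 v0 Y : 0 < size u0 -> 0 < size v0 ->
  word_cvg (fun k => (Gpair u0 v0 Y k).1) (Gseq u0 v0 Y).
Proof.
move=> u0_gt0 v0_gt0; apply: word_cvg_prefix => k /=.
  by case: Gpair => u v; case: ifP => _; exact: prefix_prefix.
suff /andP[/ltnW] : (k < size (Gpair u0 v0 Y k).1) && (k < size (Gpair u0 v0 Y k).2) by [].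
elim: k => [|k]; first by rewrite /= u0_gt0.
rewrite /=; case: Gpair => u v /= /andP[ku kv].
have add m n : k < m -> k < n -> k.+1 < m + n.
  move=> km kn; rewrite -[k.+2]addn1; apply: leq_add => //.
  exact: leq_ltn_trans kn.
by case: ifP => _; rewrite /= !size_cat !add.
Qed.

Lemma periodic_delta eps :
  periodic eps -> periodic (fun k => ~~ delta (eps k) (eps k.+1)).
Proof. by move=> [p p0 He]; exists p => // k; rewrite /= -addSn !He. Qed.

(* Main.v *)
(* The number of ones in [W_(k+1) = W_k eps_k W_k] has the parity of [eps_k].
   Hence, in the running parities of [W_(k+2) = W_(k+1) eps_(k+1) W_(k+1)], the
   second half is the first one shifted by [eps_k + eps_(k+1)], which is the
   recursion defining the pair [(u_k, v_k)]; thus [u_k = sigma(W_(k+1))], and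
   one passes to the limit by continuity of [sigma]. *)
Require Import Defs.
From mathcomp Require Import all_boot.

Lemma size_sigma_word a : size (sigma_word a) = (size a).+1.
Proof. exact: size_mkseq. Qed.

Lemma nth_sigma_word a i : i <= size a ->
  nth false (sigma_word a) i = odd (\sum_(0 <= j < i) nth false a j).
Proof. by move=> ia; rewrite nth_mkseq. Qed.

Lemma sigma_word_nil : sigma_word [::] = [:: false].
Proof. by rewrite /sigma_word /mkseq /= big_geq. Qed.

Lemma sigma_word_cons x a :
  sigma_word (x :: a) = false :: map (addb x) (sigma_word a).
Proof.
apply: (@eq_from_nth _ false) => [|[|i]].
- by rewrite size_sigma_word /= !size_map size_iota.
- by rewrite nth_sigma_word // big_geq.
rewrite size_sigma_word ltnS => ia.
rewrite -[RHS]/(nth false (map (addb x) (sigma_word a)) i).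
rewrite (nth_map false) ?size_sigma_word //.
by rewrite !nth_sigma_word // big_nat_recl // oddD oddb.
Qed.

(** The extra last letter of [sigma_word a] fills the position of [x], so the second block starts
    just after [x], with the parity of [a] and [x] already accumulated. *)
Lemma sigma_word_cat a x b :
  sigma_word (a ++ x :: b) =
  sigma_word a ++ map (addb (odd (count id a) (+) x)) (sigma_word b).
Proof.
elim: a => [|y a IH].
  by rewrite cat0s sigma_word_cons sigma_word_nil.
rewrite cat_cons !sigma_word_cons IH map_cat -map_comp cat_cons.
congr (_ :: (_ ++ _)); apply: eq_map => z.
by rewrite /= oddD oddb !addbA.
Qed.

(** The two copies of [Pword W0 eps k] cancel modulo 2, leaving the middle letter. *)
Lemma odd_count_Pword W0 eps k : odd (count id (Pword W0 eps k.+1)) = eps k.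
Proof. by rewrite /= !count_cat /= !oddD oddb addbC -addbA addbb addbF. Qed.

Lemma sigma_word_PwordS W0 eps k :
  let u := sigma_word (Pword W0 eps k.+1) in
  sigma_word (Pword W0 eps k.+2) =
  u ++ map (addb (~~ delta (eps k) (eps k.+1))) u.
Proof.
have -> : ~~ delta (eps k) (eps k.+1) = eps k (+) eps k.+1.
  by rewrite /delta; case: (eps k) (eps k.+1) => -[].
rewrite -(odd_count_Pword W0 eps k); exact: sigma_word_cat.
Qed.

(** Negation commutes with concatenation, so the second word stays the negation of the first;
    appending it is then adding the bit [Y k] to a copy of [u k]. *)
Lemma Gpair_negw (u : nat -> word) Y k :
  (forall k, u k.+1 = u k ++ map (addb (Y k)) (u k)) ->
  Gpair (u 0) (negw (u 0)) Y k = (u k, negw (u k)).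
Proof.
move=> uS; elim: k => //= k ->; rewrite uS [negw (_ ++ _)]map_cat.
have addF : map (addb false) (u k) = u k by exact: map_id.
have negwK : map negb (map negb (u k)) = u k by exact: mapK negbK _.
by case: (Y k); rewrite ?addF ?negwK.
Qed.

(** Letter [i] of [sigma] depends on all earlier letters, so its continuity needs agreement on a
    whole prefix at once. *)
Lemma word_cvg_prefix_eq w x n : word_cvg w x ->
  exists K, forall k, K <= k ->
    n <= size (w k) /\ forall j, j < n -> nth false (w k) j = x j.
Proof.
move=> wx; elim: n => [|n [K HK]]; first by exists 0.
have [M HM] := wx n; exists (maxn K M) => k; rewrite geq_max => /andP[Kk Mk].
have [lt_n eq_n] := HM _ Mk; split=> // j; rewrite ltnS leq_eqVlt.
by case/predU1P=> [->|/(HK _ Kk).2].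
Qed.

Lemma sigma_word_cvg w x :
  word_cvg w x -> word_cvg (fun k => sigma_word (w k)) (sigma x).
Proof.
move=> wx i; have [K HK] := word_cvg_prefix_eq w x i wx.
exists K => k /HK[le_i eq_w]; rewrite size_sigma_word nth_sigma_word //.
split=> //; congr odd; apply: eq_big_nat => j /andP[_ ji].
by rewrite eq_w.
Qed.

Theorem proposition3p6 (W0 : word) (eps : binseq) (heps : periodic eps) :
  let s := Pseq W0 eps in
  let W1 := W0 ++ [:: eps 0] ++ W0 in
  let u0 := sigma_word W1 in
  let v0 := negw u0 in
  sigma s = Gseq u0 v0 (fun k => ~~ delta (eps k) (eps k.+1)).
Proof.
move=> s W1 u0 v0; apply/esym/word_limP => i.
have [K HK] := sigma_word_cvg _ _ (Pseq_cvg W0 eps) i.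
(* The index is shifted by one because the parity of [W0] itself is arbitrary; the shifted sequence
   keeps the same limit. *)
exists K => k Kk; rewrite (Gpair_negw (fun k => sigma_word (Pword W0 eps k.+1))).
  exact/HK/leqW.
exact: sigma_word_PwordS.
Qed.
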